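(* Let $\mathcal{H}$ be a complex Hilbert space and let $T\in\mathcal{B}(\mathcal{H})$ be generalized Drazin invertible with closed range. With respect to the orthogonal decomposition $\mathcal{H}=\mathcal{R}(T)\oplus\mathcal{N}(T^* )$ write $$T=\begin{bmatrix} A_1 & A_2\\ 0& 0\end{bmatrix}:\begin{bmatrix}\mathcal{R}(T)\\ \mathcal{N}(T^* )\end{bmatrix}\to\begin{bmatrix}\mathcal{R}(T)\\ \mathcal{N}(T^* )\end{bmatrix},$$ and let an inner inverse of $T$ be $$T^{-}=\begin{bmatrix} Z_1 & Z_2\\ Z_3& Z_4\end{bmatrix}:\begin{bmatrix}\mathcal{R}(T)\\ \mathcal{N}(T^* )\end{bmatrix}\to\begin{bmatrix}\mathcal{R}(T)\\ \mathcal{N}(T^* )\end{bmatrix}\quad(\text{with } A_1Z_1+A_2Z_3=I).$$ Then the 1GD inverse of $T$ is given by $$T^{-GD}=\begin{bmatrix} Z_1A_1A_1^d & Z_1A_1^dA_2\\ Z_3A_1A_1^d& Z_3A_1^dA_2\end{bmatrix}=\begin{bmatrix} Z_1A_1A_1^d & Z_1A_1(A_1^d)^2A_2\\ 0&0\end{bmatrix}+\begin{bmatrix}0&0\\ Z_3A_1A_1^d& Z_3A_1^dA_2\end{bmatrix}:\begin{bmatrix}\mathcal{R}(T)\\ \mathcal{N}(T^* )\end{bmatrix}\to\begin{bmatrix}\mathcal{R}(T)\\ \mathcal{N}(T^* )\end{bmatrix}.$$ Consequently, $T^{-GD}=T^d$ if $Z_3=0$ and $A_1Z_1=Z_1A_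1$.
   Context: $\mathcal{B}(\mathcal{H})$ is the space of bounded linear operators on $\mathcal{H}$; $\mathcal{R}(\cdot)$ and $\mathcal{N}(\cdot)$ denote range and null space. An operator $Q$ is quasinilpotent if $\|Q^n\|^{1/n}\to0$. $T\in\mathcal{B}(\mathcal{H})$ is generalized Drazin invertible if there is $X\in\mathcal{B}(\mathcal{H})$ with $XTX=X$, $TX=XT$ and $T-T^2X$ quasinilpotent; such an $X$ is unique and is denoted $T^d$. An inner inverse of $T$ is $T^{-}\in\mathcal{B}(\mathcal{H})$ with $TT^{-}T=T$. The 1GD inverse of $T$ associated with a fixed inner inverse $T^{-}$ is $T^{-GD}=T^{-}TT^d$. It is known that, in the block decomposition of the claim, $A_1A_1^*+A_2A_2^*$ is positive and invertible on $\mathcal{R}(T)$, $A_1$ is generalized Drazin invertible, and $T^d=\begin{bmatrix} A_1^d & (A_1^d)^2A_2\\ 0&0\end{bmatrix}$. *)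

(* Defs.v *)
From HB Require Import structures.
From mathcomp Require Import all_boot all_order all_algebra.
From mathcomp Require Import sesquilinear complex ring lra.
From mathcomp Require Import all_classical all_reals all_analysis.

Set Implicit Arguments.
Unset Strict Implicit.
Unset Printing Implicit Defensive.

Import Order.TTheory GRing.Theory Num.Theory.
Import numFieldNormedType.Exports.

Local Open Scope classical_set_scope.
Local Open Scope ring_scope.

(* The inner product is linear in its first argument. *)
HB.mixin Record CompleteNormedModule_isHilbert (R : realType) H
    & CompleteNormedModule R[i] H := {
  inner : {dot H for @Num.conj R[i]} ;
  inner_norm : forall x : H, `|x| ^+ 2 = inner x x }.

#[short(type="hilbertType")]
HB.structure Definition Hilbert (R : realType) :=
  {H of CompleteNormedModule R[i] H & CompleteNormedModule_isHilbert R H}.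

Section BoundedOperators.
Variable R : realType.
Implicit Types H K L : hilbertType R.

Record bop H K := Bop {
  bop_fun :> H -> K ;
  bop_linear : linear bop_fun ;
  bop_bounded : exists c : R, forall x, `|bop_fun x| <= c%:C%C * `|x| }.

HB.instance Definition _ H K (T : bop H K) :=
  GRing.isLinear.Build R[i] H K _ (bop_fun T) (bop_linear T).
HB.instance Definition _ H K := gen_eqMixin (bop H K).
HB.instance Definition _ H K := gen_choiceMixin (bop H K).

Lemma bopP H K (S T : bop H K) : S =1 T -> S = T.
Proof.
case: S T => [f lf bf] [g lg bg] /= /funext fg; rewrite -fg in lg bg *.
by congr Bop; exact: Prop_irrelevance.
Qed.

Lemma bop_bounded_pos H K (T : bop H K) :
  exists2 c : R, 0 <= c & forall x, `|T x| <= c%:C%C * `|x|.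
Proof.
have [c Tc] := bop_bounded T; exists `|c|; first exact: normr_ge0.
move=> x; apply: le_trans (Tc x) _; apply: ler_wpM2r => //.
by rewrite lecR ler_norm.
Qed.

Fact bop0_linear H K : linear (fun _ : H => 0 : K).
Proof. by move=> a x y; rewrite scaler0 addr0. Qed.

Fact bop0_bounded H K :
  exists c : R, forall x : H, `|0 : K| <= c%:C%C * `|x|.
Proof. by exists 0 => x; rewrite normr0 mul0r. Qed.

Definition bop0 H K := Bop (@bop0_linear H K) (@bop0_bounded H K).

Fact bopN_linear H K (T : bop H K) : linear (fun x => - T x).
Proof. by move=> a x y; rewrite linearP opprD scalerN. Qed.

Fact bopN_bounded H K (T : bop H K) :
  exists c : R, forall x, `|- T x| <= c%:C%C * `|x|.
Proof. by have [c Tc] := bop_bounded T; exists c => x; rewrite normrN. Qed.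

Definition bopN H K (T : bop H K) := Bop (bopN_linear T) (bopN_bounded T).

Fact bopD_linear H K (S T : bop H K) : linear (fun x => S x + T x).
Proof. by move=> a x y; rewrite !linearP scalerDr addrACA. Qed.

Fact bopD_bounded H K (S T : bop H K) :
  exists c : R, forall x, `|S x + T x| <= c%:C%C * `|x|.
Proof.
have [c Sc] := bop_bounded S; have [d Td] := bop_bounded T; exists (c + d).
move=> x; apply: le_trans (ler_normD _ _) _.
by rewrite rmorphD mulrDl lerD.
Qed.

Definition bopD H K (S T : bop H K) := Bop (bopD_linear S T) (bopD_bounded S T).

Fact bopDA H K : associative (@bopD H K).
Proof. by move=> S T U; apply: bopP => x /=; rewrite addrA. Qed.

Fact bopDC H K : commutative (@bopD H K).
Proof. by move=> S T; apply: bopP => x /=; rewrite addrC. Qed.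

Fact bop0D H K : left_id (bop0 H K) (@bopD H K).
Proof. by move=> T; apply: bopP => x /=; rewrite add0r. Qed.

Fact bopND H K : left_inverse (bop0 H K) (@bopN H K) (@bopD H K).
Proof. by move=> T; apply: bopP => x /=; rewrite addNr. Qed.

HB.instance Definition _ H K := GRing.isZmodule.Build (bop H K)
  (@bopDA H K) (@bopDC H K) (@bop0D H K) (@bopND H K).

Fact bcomp_linear H K L (S : bop K L) (T : bop H K) : linear (S \o T).
Proof. by move=> a x y; rewrite /= !linearP. Qed.

Fact bcomp_bounded H K L (S : bop K L) (T : bop H K) :
  exists c : R, forall x, `|(S \o T) x| <= c%:C%C * `|x|.
Proof.
have [c c0 Sc] := bop_bounded_pos S; have [d Td] := bop_bounded T.
exists (c * d) => x /=; apply: le_trans (Sc _) _.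
by rewrite rmorphM -mulrA ler_wpM2l // lecR.
Qed.

Definition bcomp H K L (S : bop K L) (T : bop H K) : bop H L :=
  Bop (bcomp_linear S T) (bcomp_bounded S T).

Fact bid_linear H : linear (@idfun H).
Proof. by []. Qed.

Fact bid_bounded H : exists c : R, forall x : H, `|idfun x| <= c%:C%C * `|x|.
Proof. by exists 1 => x; rewrite rmorph1 mul1r. Qed.

Definition bid H := Bop (@bid_linear H) (@bid_bounded H).

Fact bcompA H : associative (@bcomp H H H).
Proof. by move=> S T U; exact: bopP. Qed.

Fact bcomp1o H : left_id (bid H) (@bcomp H H H).
Proof. by move=> T; exact: bopP. Qed.

Fact bcompo1 H : right_id (bid H) (@bcomp H H H).
Proof. by move=> T; exact: bopP. Qed.

Fact bcompDl H : left_distributive (@bcomp H H H) +%R.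
Proof. by move=> S T U; exact: bopP. Qed.

Fact bcompDr H : right_distributive (@bcomp H H H) +%R.
Proof. by move=> S T U; apply: bopP => x /=; rewrite linearD. Qed.

(* B(H) is a possibly zero ring, as H may be the zero space. *)
HB.instance Definition _ H := GRing.Zmodule_isPzRing.Build (bop H H)
  (@bcompA H) (@bcomp1o H) (@bcompo1 H) (@bcompDl H) (@bcompDr H).

(* Norms of H are (real) elements of R[i]; the operator norm lives in R. *)
Definition opnorm H K (T : bop H K) : R :=
  sup [set complex.Re `|T x| | x in [set x : H | `|x| <= 1]].

Definition quasinilpotent H (Q : bop H H) :=
  (fun n : nat => opnorm (Q ^+ n) `^ n%:R^-1) @ \oo --> (0 : R).

Definition is_gdrazin H (T X : bop H H) :=
  [/\ X * T * X = X, T * X = X * T & quasinilpotent (T - T ^+ 2 * X)].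

Definition gdrazin_invertible H (T : bop H H) := exists X, is_gdrazin T X.

(* A solution of is_gdrazin is unique when it exists, so that xget introduces
   no ambiguity; the value is 0 when T is not generalized Drazin invertible. *)
Definition gdrazin H (T : bop H H) : bop H H := xget 0 [set X | is_gdrazin T X].

Definition inner_inverse H (T Tm : bop H H) := T * Tm * T = T.

Definition one_gd_inverse H (T Tm : bop H H) : bop H H := Tm * T * gdrazin T.

Definition is_adjoint H K (T : bop H K) (S : bop K H) :=
  forall x y, inner (T x) y = inner x (S y).

(* Well defined by adjointP below (Riesz representation). *)
Definition adjoint H K (T : bop H K) : bop K H := xget 0 [set S | is_adjoint T S].

Record csubspace H := CSubspace {
  csub_set : set H ;
  csub0 : csub_set 0 ;
  csubP : forall (a : R[i]) x y, csub_set x -> csub_set y -> csub_set (a *: x + y) ;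
  csub_closed : closed csub_set }.

End BoundedOperators.

Notation "S '\oB' T" := (bcomp S T) (at level 40, left associativity) : ring_scope.
Notation "T ^D" := (gdrazin T) (at level 1, format "T ^D") : ring_scope.

(* A closed subspace as a Hilbert space of its own, with the induced structure. *)
Section SubspaceHilbert.
Variables (R : realType) (H : hilbertType R) (M : csubspace H).

Definition csub_pred : {pred H} := mem (csub_set M).

Record csub_carrier := CSub { csub_val : H ; _ : csub_val \in csub_pred }.

HB.instance Definition _ := [isSub for csub_val].
HB.instance Definition _ := [Choice of csub_carrier by <:].

Fact csub_submod : submod_closed csub_pred.
Proof.
split=> [|a x y]; first exact/mem_set/csub0.
by move=> /set_mem Mx /set_mem My; apply/mem_set/csubP.
Qed.

HB.instance Definition _ :=
  GRing.SubChoice_isSubLmodule.Build R[i] H csub_pred csub_carrier csub_submod.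

Fact csub_norm0 (x : csub_carrier) : `|val x| = 0 -> x = 0.
Proof. by move=> /normr0_eq0 x0; apply: val_inj; rewrite x0 raddf0. Qed.

Fact csub_normD (x y : csub_carrier) : `|val (x + y)| <= `|val x| + `|val y|.
Proof. by rewrite raddfD ler_normD. Qed.

Fact csub_normZ (a : R[i]) (x : csub_carrier) : `|val (a *: x)| = `|a| * `|val x|.
Proof. by rewrite linearZ normrZ. Qed.

HB.instance Definition _ := @Lmodule_isNormed.Build R[i] csub_carrier
  (fun x => `|val x|)
  csub_normD csub_normZ csub_norm0.

Fact csub_complete (F : set_system csub_carrier) :
  ProperFilter F -> cauchy F -> cvg F.
Proof.
move=> FF Fc.
have vD (x y : csub_carrier) : val (x - y) = val x - val y by rewrite raddfB.
have /cauchy_ballP Fb := Fc.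
have : cauchy_ball (val @ F : set_system H).
  move=> e e0; rewrite near_map2; move: (Fb e e0); apply: filterS => -[x y].
  by rewrite /= -!ball_normE /= -vD.
move=> /cauchy_ballP/cauchy_cvg/cvg_ex [l Fl].
have Ml : csub_set M l.
  apply: (@closed_cvg _ _ F FF val (csub_set M)) Fl; first exact: csub_closed.
  by apply: nearW => -[x] /= /set_mem.
apply/cvg_ex; exists (CSub (mem_set Ml : l \in csub_pred)).
apply/cvgrPdist_lt => e e0; move/cvgrPdist_lt: Fl => /(_ e e0).
by apply: filterS => x /=; rewrite -[`|CSub _ - x|]/(`|val (CSub _ - x)|) vD.
Qed.

HB.instance Definition _ := Uniform_isComplete.Build csub_carrier csub_complete.

Definition csub_inner (x y : csub_carrier) : R[i] := inner (val x) (val y).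

Fact csub_inner_bilinear :
  bilinear_for *%R (@Num.conj R[i] \; *%R) csub_inner.
Proof.
by split=> u a x y; rewrite /csub_inner (linearP val) ?linearPl ?linearPr.
Qed.

HB.instance Definition _ := bilinear_isBilinear.Build R[i] csub_carrier
  csub_carrier R[i] _ _ csub_inner csub_inner_bilinear.

Fact csub_inner_hermitian x y :
  csub_inner x y = (-1) ^+ false * (csub_inner y x)^*.
Proof. exact: hermC. Qed.

HB.instance Definition _ := isHermitianSesquilinear.Build R[i] csub_carrier
  false (@Num.conj R[i]) csub_inner csub_inner_hermitian.

Fact csub_inner_gt0 x : x != 0 -> 0 < csub_inner x x.
Proof.
move=> x0; apply: neq0_dnorm_gt0; apply: contra x0 => /eqP x0.
by apply/eqP/val_inj; rewrite x0 raddf0.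
Qed.

HB.instance Definition _ :=
  isDotProduct.Build R[i] csub_carrier csub_inner csub_inner_gt0.

Fact csub_inner_norm (x : csub_carrier) : `|x| ^+ 2 = csub_inner x x.
Proof. exact: inner_norm. Qed.

HB.instance Definition _ :=
  CompleteNormedModule_isHilbert.Build R csub_carrier csub_inner_norm.

End SubspaceHilbert.

Definition csub_hilbert (R : realType) (H : hilbertType R) (M : csubspace H) :
  hilbertType R := csub_carrier M.
Coercion csub_hilbert : csubspace >-> Hilbert.type.

Section Projection.
Variables (R : realType) (H : hilbertType R).
Implicit Types (M : csubspace H) (x y z : H).

Fact csub_incl_linear M : linear (fun x : M => \val x : H).
Proof. by move=> a x y; exact: linearP. Qed.

Fact csub_incl_bounded M : exists c : R, forall x : M, `|\val x| <= c%:C%C * `|x|.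
Proof. by exists 1 => x; rewrite rmorph1 mul1r. Qed.

Definition csub_incl M : bop M H :=
  Bop (@csub_incl_linear M) (csub_incl_bounded M).

Definition is_ortho_proj M (P : bop H M) :=
  forall x (m : M), inner (x - csub_incl M (P x)) (csub_incl M m) = 0.

(* Well defined by ortho_projP below. *)
Definition ortho_proj M : bop H M := xget 0 [set P | @is_ortho_proj M P].

Lemma innerC x y : inner x y = (inner y x)^*.
Proof. by rewrite hermC expr0 mul1r. Qed.

Lemma innerBl x y z : inner (x - y) z = inner x z - inner y z.
Proof. exact: linearBl. Qed.

Lemma innerPl a x y z : inner (a *: x + y) z = a * inner x z + inner y z.
Proof. exact: linearPl. Qed.

Lemma inner_eq0 x : inner x x = 0 -> x = 0.
Proof.
by rewrite -inner_norm => /eqP; rewrite expf_eq0 normr_eq0 => /eqP.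
Qed.

Let sq x : R := complex.Re (inner x x).

Let sqE x : inner x x = (sq x)%:C%C.
Proof.
by rewrite RRe_real// -inner_norm ger0_real// exprn_ge0.
Qed.

Let sqN x : (sq x)%:C%C = `|x| ^+ 2.
Proof. by rewrite inner_norm sqE. Qed.

Let sq_ge0 x : 0 <= sq x.
Proof. by rewrite -lecR sqN exprn_ge0. Qed.

Let sq_eq0 x : sq x = 0 -> x = 0.
Proof. by move=> x0; apply: inner_eq0; rewrite sqE x0. Qed.

Let sqB x y : sq (x - y) = sq (y - x).
Proof. by rewrite /sq -(opprB y) hnormN. Qed.

Let N x : R := complex.Re `|x|.

Let NE x : (N x)%:C%C = `|x|.
Proof. by rewrite RRe_real ?ger0_real. Qed.

Let N_ge0 x : 0 <= N x.
Proof. by rewrite -lecR NE normr_ge0. Qed.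

Let sqEN x : sq x = N x ^+ 2.
Proof. by apply: complexI; rewrite sqN rmorphXn /= NE. Qed.

Let ler_ND x y : N (x + y) <= N x + N y.
Proof. by rewrite -lecR rmorphD /= !NE ler_normD. Qed.

Let parallelogram x y :
  sq (x + y) + sq (x - y) = (sq x + sq x) + (sq y + sq y).
Proof.
apply: complexI; rewrite !rmorphD /= -!sqE !hnormD hnormN linearNr.
rewrite expr0 !mul1r rmorphN.
set a := inner x x; set b := inner y y; set c := inner x y.
by rewrite -opprD addrACA subrr addr0 addrACA.
Qed.

Let sqZ (a : R[i]) x : (sq (a *: x))%:C%C = `|a| ^+ 2 * (sq x)%:C%C.
Proof. by rewrite !sqN normrZ exprMn. Qed.

Let min_ortho z y : (forall a : R[i], sq z <= sq (z - a *: y)) -> inner z y = 0.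
Proof.
have [->|y0] := eqVneq y 0; first by rewrite linear0r.
have b0 : 0 < inner y y by exact: neq0_dnorm_gt0.
move=> /(_ (inner z y / inner y y)); rewrite -lecR -!sqE hnormB.
rewrite linearZl_LR !linearZr_LR /=.
have bc : (inner y y)^* = inner y y by apply: CrealP; exact: gtr0_real.
rewrite expr0 mul1r !rmorphM /= conjCK fmorphV /= bc.
set b := inner y y in b0 bc *; set c := inner z y.
rewrite -subr_ge0 fmorphV /= bc [_ *: _]mulrC.
have -> : inner z z + c / b * b * (c^* / b) -
  (c^* / b * c + c / b * c^*) - inner z z = - (c * c^* / b).
  by field; rewrite gt_eqF.
rewrite oppr_ge0 -normCK pmulr_lle0 ?invr_gt0// => c0; apply/eqP.
have : `|c| ^+ 2 == 0 by rewrite eq_le c0 exprn_ge0.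
by rewrite expf_eq0 /= normr_eq0.
Qed.

Lemma ortho_proj_point M x : exists m : M,
  forall n : M, inner (x - csub_incl M m) (csub_incl M n) = 0.
Proof.
pose D := [set sq (x - csub_incl M m) | m in [set: M]].
have D0 : D !=set0 by exists (sq (x - csub_incl M (0 : M))), 0.
have lbD : lbound D 0 by move=> _ [m _ <-].
have infD : has_inf D by split=> //; exists 0.
pose d := inf D.
have dle (m : M) : d <= sq (x - csub_incl M m).
  by apply: ge_inf; [exists 0 | exists m].
have /choice[u ud] (k : nat) : exists m : M, sq (x - csub_incl M m) < d + k.+1%:R^-1.
  have k0 : 0 < k.+1%:R^-1 :> R by rewrite invr_gt0.
  by have [_ [m _ <-] md] := inf_adherent k0 infD; exists m.
have usq n k : sq (csub_incl M (u n) - csub_incl M (u k)) <= (n.+1%:R^-1 + k.+1%:R^-1) *+ 2.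
  have := parallelogram (x - csub_incl M (u n)) (x - csub_incl M (u k)).
  have -> : x - csub_incl M (u n) + (x - csub_incl M (u k)) =
      2 *: (x - csub_incl M (2^-1 *: (u n + u k))).
    rewrite scalerBr -(linearZ_LR (csub_incl M)) /= scalerA divff ?pnatr_eq0// scale1r raddfD.
    by rewrite scaler_nat mulr2n addrACA -opprD.
  have -> : x - csub_incl M (u n) - (x - csub_incl M (u k)) = csub_incl M (u k) - csub_incl M (u n).
    by rewrite opprB addrC addrA subrK.
  have -> z : sq (2 *: z) = 4 * sq z.
    apply: complexI; rewrite sqZ rmorphM /= normr_nat; congr (_ * _).
    by rewrite -natrX rmorph_nat.
  have := dle (2^-1 *: (u n + u k)); have := ud n; have := ud k.
  rewrite (sqB (csub_incl M (u k))) => h1 h2 h3 h4.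
  rewrite mulr2n; set p := n.+1%:R^-1 in h2 *; set q := k.+1%:R^-1 in h1 *; lra.
have inclN (a b : M) : `|a - b| = (N (csub_incl M a - csub_incl M b))%:C%C.
  by rewrite NE -linearB.
have uc : cauchy (u @ \oo).
  apply/cauchy_ballP => e e0.
  have eE : (complex.Re e)%:C%C = e by rewrite RRe_real// gtr0_real.
  have e'0 : 0 < complex.Re e by rewrite -ltcR eE.
  have e4 : 0 < complex.Re e ^+ 2 / 4 by rewrite divr_gt0// exprn_gt0.
  rewrite near_map2; near=> n k; rewrite -ball_normE /= inclN -eE ltcR.
  have /= nD : n.+1%:R^-1 < complex.Re e ^+ 2 / 4.
    by near: n; exact: near_infty_natSinv_lt (PosNum e4).
  have /= kD : k.+1%:R^-1 < complex.Re e ^+ 2 / 4.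
    by near: k; exact: near_infty_natSinv_lt (PosNum e4).
  rewrite -(@ltr_pXn2r _ 2)// ?nnegrE//; last exact: ltW.
  rewrite -sqEN; have := usq n k; rewrite mulr2n; set p := n.+1%:R^-1 in nD *; set q := k.+1%:R^-1 in kD *; move=> h; lra.
have /cauchy_cvg/cvg_ex[m um] := uc.
have d0 : 0 <= d by apply: lb_le_inf.
have dm : sq (x - csub_incl M m) = d.
  apply/le_anti/andP; split; last exact: dle.
  apply/ler_addgt0Pr => eps eps0.
  pose e := Num.min 1 (eps / (2 * d + 6)).
  have D6 : 0 < 2 * d + 6 by lra.
  have e0 : 0 < e by rewrite lt_min ltr01 divr_gt0.
  have e1 : e <= 1 by rewrite ge_min lexx.
  have eeps : e * (2 * d + 6) <= eps by rewrite -ler_pdivlMr// ge_min lexx orbT.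
  have ec0 : 0 < e%:C%C by rewrite ltcR.
  have /cvgrPdist_lt/(_ _ ec0) ume := um.
  near \oo => n.
  have : `|m - u n| < e%:C%C by near: n; exact: ume.
  rewrite inclN ltcR.
  have : n.+1%:R^-1 < e by near: n; exact: near_infty_natSinv_lt (PosNum e0).
  have := ud n; have := ler_ND (x - csub_incl M (u n)) (csub_incl M (u n) - csub_incl M m).
  rewrite addrA subrK (_ : N (csub_incl M (u n) - csub_incl M m) = N (csub_incl M m - csub_incl M (u n))); last first.
    by rewrite /N distrC.
  rewrite !sqEN.
  have := N_ge0 (x - csub_incl M (u n)); have := N_ge0 (x - csub_incl M m).
  have := N_ge0 (csub_incl M m - csub_incl M (u n)).
  set r := N (x - _ m); set s := N (x - _ (u n)); set t := N _; set p := n.+1%:R^-1.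
  move=> t0 r0 s0 rst sd ne te.
  have r2 : r ^+ 2 <= (s + t) ^+ 2 by rewrite ler_pXn2r// nnegrE addr_ge0.
  have s1 : s <= 1 + s ^+ 2 by nra.
  have st : s * t <= (2 + d) * e by apply: ler_pM => //; [lra|exact: ltW].
  have tt : t * t <= e by nra.
  nra.
exists m => n; apply: min_ortho => a.
rewrite dm; have := dle (m + a *: n).
by rewrite (linearD (csub_incl M)) linearZ_LR /= opprD addrA.
Unshelve. all: by end_near. Qed.

Let pythagoras x y : inner x y = 0 -> N x <= N (x + y).
Proof.
move=> xy; rewrite -(@ler_pXn2r _ 2)// ?nnegrE// -!sqEN -lecR -!sqE.
by rewrite hnormDd// lerDl -[leRHS]/(inner y y) sqE lecR.
Qed.

Lemma ortho_proj_uniq M x (m m' : M) :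
  (forall n : M, inner (x - csub_incl M m) (csub_incl M n) = 0) ->
  (forall n : M, inner (x - csub_incl M m') (csub_incl M n) = 0) -> m = m'.
Proof.
move=> mP m'P; apply: val_inj; apply/eqP; rewrite -subr_eq0; apply/eqP.
apply: inner_eq0; rewrite -[LHS]/(inner (csub_incl M (m - m')) (csub_incl M (m - m'))).
have {1}-> : csub_incl M (m - m') = (x - csub_incl M m') - (x - csub_incl M m).
  by rewrite linearB /= opprB [RHS]addrC addrA subrK.
by rewrite innerBl m'P mP subrr.
Qed.

Lemma ortho_proj_exists M : exists P, @is_ortho_proj M P.
Proof.
have /choice[P PP] := ortho_proj_point M.
have Pl : linear P.
  move=> a x y; apply: (@ortho_proj_uniq M (a *: x + y)) => [//|n].
  rewrite (linearP (csub_incl M)) opprD addrACA -scalerBr innerPl !PP.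
  by rewrite mulr0 addr0.
have Pb : exists c : R, forall x, `|P x| <= c%:C%C * `|x|.
  exists 1 => x; rewrite rmorph1 mul1r.
  have := @pythagoras (csub_incl M (P x)) (x - csub_incl M (P x)).
  by rewrite [X in _ <= N X]addrC subrK -lecR !NE innerC PP rmorph0; exact.
by exists (Bop Pl Pb).
Qed.

Lemma ortho_projP M : is_ortho_proj (ortho_proj M).
Proof. by have := xgetPex 0 (ortho_proj_exists M). Qed.

Lemma kernel_closed (W : normedModType R[i]) (f : {linear H -> W}) :
  (exists c : R, forall x, `|f x| <= c%:C%C * `|x|) -> closed [set x | f x = 0].
Proof.
move=> [c fc]; have fcont : continuous f.
  apply: bounded_linear_continuous; apply/linear_boundedP.
  exists c%:C%C; split; first by apply/complex_realP; exists c.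
  move=> r cr x; apply: le_trans (fc x) _.
  by apply: ler_wpM2r => //; exact: ltW.
have -> : [set x | f x = 0] = f @^-1` [set 0] by apply/seteqP; split.
by apply: closed_comp => [x _|]; [exact: fcont | exact/accessible_closed_set1/hausdorff_accessible/norm_hausdorff].
Qed.

Lemma innerZl a x y : inner (a *: x) y = a * inner x y.
Proof. exact: linearZl_LR. Qed.

Lemma innerZr a x y : inner x (a *: y) = a^* * inner x y.
Proof. exact: linearZr_LR. Qed.

Lemma innerDr x y z : inner x (y + z) = inner x y + inner x z.
Proof. exact: linearDr. Qed.

Lemma innerBr x y z : inner x (y - z) = inner x y - inner x z.
Proof. exact: linearBr. Qed.

Lemma cauchy_schwarz x y : `|inner x y| <= `|x| * `|y|.
Proof.
have [->|y0] := eqVneq y 0; first by rewrite linear0r !normr0 mulr0.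
have b0 : 0 < inner y y by exact: neq0_dnorm_gt0.
pose a := inner x y / inner y y.
have aE : a * inner y y = inner x y by rewrite divfK ?gt_eqF.
have o : inner (a *: y) (x - a *: y) = 0.
  by rewrite innerZl innerC innerBl innerZl aE subrr rmorph0 mulr0.
have := pythagoras o; rewrite [X in _ <= N X]addrC subrK -lecR !NE normrZ => ax.
rewrite -aE normrM -inner_norm normrX normr_id expr2 mulrA.
by rewrite ler_wpM2r.
Qed.

Lemma inner_ext x y : (forall z, inner z x = inner z y) -> x = y.
Proof.
move=> xy; apply/eqP; rewrite -subr_eq0; apply/eqP/inner_eq0.
by rewrite innerBr xy subrr.
Qed.

Lemma riesz (f : {linear H -> R[i]^o}) :
  (exists c : R, forall x, `|f x| <= c%:C%C * `|x|) ->
  exists y, forall x, f x = inner x y.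
Proof.
move=> fb.
have Kl (a : R[i]) x y : f x = 0 -> f y = 0 -> f (a *: x + y) = 0.
  by move=> fx fy; rewrite linearP fx fy scaler0 addr0.
pose K := @CSubspace R H [set x | f x = 0] (raddf0 f) Kl (kernel_closed fb).
have [/(_ _)/eqP f0|] := pselect (forall x, f x = 0).
  by exists 0 => x; rewrite linear0r; exact/eqP.
move=> /existsNP[z /eqP fz].
pose w := z - csub_incl K (ortho_proj K z).
have fw : f w = f z.
  rewrite linearB /=; case: (ortho_proj K z) => v /= vK.
  by move/set_mem: vK => /= ->; rewrite subr0.
have wK x : f x = 0 -> inner w x = 0.
  move=> fx; have xK : x \in csub_pred K by exact/mem_set.
  exact: (@ortho_projP K z (CSub xK)).
have w0 : w != 0 by apply: contra_neq fz => w0; rewrite -fw w0 linear0.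
have b0 : 0 < inner w w by exact: neq0_dnorm_gt0.
exists ((f w / inner w w)^* *: w) => x.
have : inner w (f x *: w - f w *: x) = 0.
  by apply: wK; rewrite (linearB f) (linearZ_LR f) (linearZ_LR f) /GRing.scale /= mulrC subrr.
rewrite innerC innerBl !innerZl => /eqP; rewrite fmorph_eq0 subr_eq0 => /eqP e.
rewrite innerZr conjCK mulrAC -e mulfK// gt_eqF//.
Qed.

End Projection.

Section Adjoint.
Variables (R : realType) (H K : hilbertType R).

Lemma adjoint_exists (T : bop H K) : exists S, is_adjoint T S.
Proof.
have [c c0 Tc] := bop_bounded_pos T.
have Ty (y : K) : exists z : H, forall x : H, inner (T x) y = inner x z.
  have fl : linear (fun x : H => inner (T x) y : R[i]^o).
    by move=> a u v; rewrite linearP innerPl.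
  pose L := GRing.isLinear.Build R[i] H R[i]^o _ _ fl.
  pose f : {linear H -> R[i]^o} := HB.pack (fun x : H => inner (T x) y : R[i]^o) L.
  apply: (riesz (f := f)).
  exists (c * complex.Re `|y|) => x.
  rewrite rmorphM /= RRe_real ?ger0_real// mulrAC.
  apply: le_trans (cauchy_schwarz _ _) _.
  by rewrite ler_wpM2r.
have /choice[S SP] := Ty.
have Sl : linear S.
  move=> a x y; apply: inner_ext => z.
  by rewrite -SP !innerDr !innerZr !SP.
have Sb : exists c : R, forall x, `|S x| <= c%:C%C * `|x|.
  exists c => y.
  have [->|s0] := eqVneq (S y) 0.
    by rewrite normr0 mulr_ge0// lecR.
  have s1 : 0 < `|S y| by rewrite normr_gt0.
  rewrite -(ler_pM2r s1) -expr2 inner_norm -SP.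
  have -> : inner (T (S y)) y = `|inner (T (S y)) y|.
    by rewrite ger0_norm// SP -inner_norm exprn_ge0.
  apply: le_trans (cauchy_schwarz _ _) _.
  by rewrite mulrAC ler_wpM2r.
by exists (Bop Sl Sb) => x y; exact: SP.
Qed.

Lemma adjointP (T : bop H K) : is_adjoint T (adjoint T).
Proof. by have := xgetPex 0 (adjoint_exists T). Qed.

End Adjoint.

Section RangeKernel.
Variable R : realType.
Implicit Types H K : hilbertType R.

Definition csub_ker H K (T : bop H K) : csubspace H.
Proof.
apply: (@CSubspace R H [set x | T x = 0]).
- exact: raddf0.
- by move=> a x y /= Tx Ty; rewrite linearP /= Tx Ty scaler0 addr0.
- exact: kernel_closed (bop_bounded T).
Defined.

Definition csub_ran H K (T : bop H K) (clT : closed (range T)) : csubspace K.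
Proof.
apply: (@CSubspace R K (range T)) => //.
- by exists 0 => //; exact: raddf0.
- by move=> a _ _ [x _ <-] [y _ <-]; exists (a *: x + y) => //; rewrite linearP.
Defined.

(* K = ran T (+) ker (adjoint T) orthogonally when ran T is closed. *)
Lemma ran_ker_decomp H K (T : bop H K) (clT : closed (range T)) (y : K) :
  y = csub_incl _ (ortho_proj (csub_ran clT) y) +
      csub_incl _ (ortho_proj (csub_ker (adjoint T)) y).
Proof.
set P := ortho_proj _; set Q := ortho_proj _.
have vK : y - csub_incl _ (P y) \in csub_pred (csub_ker (adjoint T)).
  apply/mem_set => /=; apply: inner_ext => z; rewrite -adjointP linear0r.
  have zT : T z \in csub_pred (csub_ran clT) by apply/mem_set => /=; exists z.
  by rewrite innerC (ortho_projP (M := csub_ran clT) y (CSub zT)) rmorph0.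
have -> : Q y = CSub vK; last by rewrite /= addrC subrK.
apply: (@ortho_proj_uniq _ _ _ y) => n; first exact: ortho_projP.
rewrite /= opprB addrC subrK.
case: (P y) => v /= /set_mem[z _ <-]; case: n => n /= /set_mem /= Tn.
by rewrite adjointP Tn linear0r.
Qed.

(* The operator matrix [A, B; C, D] with respect to H = M (+) N; meaningful when
   N is the orthogonal complement of M, as in ran_ker_decomp. *)
Definition block H (M N : csubspace H)
    (A : bop M M) (B : bop N M) (C : bop M N) (D : bop N N) : bop H H :=
  csub_incl M \oB (A \oB ortho_proj M + B \oB ortho_proj N) +
  csub_incl N \oB (C \oB ortho_proj M + D \oB ortho_proj N).

End RangeKernel.

(* Main.v *)
Require Import Defs.
From HB Require Import structures.
From mathcomp Require Import all_boot all_order all_algebra.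
From mathcomp Require Import sesquilinear complex ring.
From mathcomp Require Import all_classical all_reals all_analysis.

Import Order.TTheory GRing.Theory Num.Theory.
Import numFieldNormedType.Exports.

Local Open Scope classical_set_scope.
Local Open Scope ring_scope.

(** Let V be the inclusion of the range of T and U = A1 P + A2 Q, where P and Q
    are the orthogonal projections onto ran T and ker T*.  Then T = V U and
    A1 = U V, so Cline's formula transports generalized Drazin inverses between
    T and A1, and gives T^d = V (A1^d)^2 U by uniqueness.  As U maps H onto
    ran T and V is injective, T T^- T = T cancels to U T^- V = 1, that is
    A1 Z1 + A2 Z3 = 1, and T^- T T^d = T^- V A1^d U is read off in blocks. *)

(** * Operator norm estimates and quasinilpotence *)

Lemma opnorm_le {R : realType} {H K : hilbertType R} (T : bop H K) (c : R) :
  0 <= c -> (forall x, `|T x| <= c%:C%C * `|x|) -> opnorm T <= c.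
Proof.
move=> c0 Tc; apply: ge_sup.
  by exists (complex.Re `|T 0|), 0 => //=; rewrite normr0 ler01.
move=> _ [x /= x1 <-]; rewrite -lecR RRe_real ?ger0_real//.
by apply: le_trans (Tc x) _; rewrite ler_piMr// lecR.
Qed.

Lemma opnorm_ub {R : realType} {H K : hilbertType R} (T : bop H K) (x : H) :
  `|x| <= 1 -> complex.Re `|T x| <= opnorm T.
Proof.
move=> x1; apply: ub_le_sup; last by exists x.
have [c c0 Tc] := bop_bounded_pos T; exists c => _ [y /= y1 <-].
rewrite -lecR RRe_real ?ger0_real//.
by apply: le_trans (Tc y) _; rewrite ler_piMr// lecR.
Qed.

Lemma opnorm_ge0 {R : realType} {H K : hilbertType R} (T : bop H K) :
  0 <= opnorm T.
Proof.
have <- : complex.Re `|T 0| = 0 by rewrite linear0 normr0.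
by apply: opnorm_ub; rewrite normr0.
Qed.

Lemma opnormP {R : realType} {H K : hilbertType R} (T : bop H K) (x : H) :
  `|T x| <= (opnorm T)%:C%C * `|x|.
Proof.
have [->|x0] := eqVneq x 0; first by rewrite linear0 !normr0 mulr0.
have nx0 : 0 < `|x| by rewrite normr_gt0.
have : `|(`|x|)^-1 *: x| <= 1.
  by rewrite normrZ normfV normr_id mulVf ?normr_eq0.
move=> /(opnorm_ub T); rewrite -lecR RRe_real ?ger0_real//.
by rewrite linearZ_LR normrZ normfV normr_id ler_pdivrMl// mulrC.
Qed.

(** Pointwise geometric bounds replace suprema and real powers in all later estimates. *)
Lemma quasinilpotentP {R : realType} {H : hilbertType R} (Q : bop H H) :
  quasinilpotent Q <-> forall e : R, 0 < e ->
    \forall n \near \oo, forall x, `|(Q ^+ n) x| <= (e ^+ n)%:C%C * `|x|.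
Proof.
split=> [Q0 e e0|Qe].
  move/cvgr0Pnorm_lt: Q0 => /(_ e e0) Qe.
  near=> n => x; apply: le_trans (opnormP _ _) _.
  rewrite ler_wpM2r// lecR.
  (* At [n = 0] the exponent [n%:R^-1] is 0, and raising to the power [n] does not undo it. *)
  have n0 : (0 < n)%N by near: n; exact: nbhs_infty_gt.
  have : opnorm (Q ^+ n) `^ n%:R^-1 <= e.
    by apply/ltW/(le_lt_trans (ler_norm _)); near: n; exact: Qe.
  move=> /(lerXn2r n); rewrite !nnegrE powR_ge0 (ltW e0) => /(_ isT isT).
  rewrite -[X in X <= _]powR_mulrn ?powR_ge0// -powRrM.
  by rewrite mulVf ?pnatr_eq0 -?lt0n// powRr1// opnorm_ge0.
apply/cvgr0Pnorm_le => e e0; near=> n.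
have n0 : (0 < n)%N by near: n; exact: nbhs_infty_gt.
rewrite ger0_norm ?powR_ge0//.
have : opnorm (Q ^+ n) <= e ^+ n.
  by apply: opnorm_le; [rewrite exprn_ge0 ?(ltW e0)|near: n; exact: Qe].
move=> /(ge0_ler_powR (r := n%:R^-1)).
rewrite !nnegrE invr_ge0 ler0n opnorm_ge0.
rewrite exprn_ge0 ?(ltW e0)// => /(_ isT isT isT) /le_trans; apply.
rewrite -[X in X `^ _ <= _]powR_mulrn ?(ltW e0)// -powRrM.
by rewrite mulfV ?pnatr_eq0 -?lt0n// powRr1 ?(ltW e0).
Unshelve. all: by end_near. Qed.

Lemma near_le_geometric {R : realType} (c d : R) :
  0 < d -> \forall n \near \oo, c * (2^-1) ^+ n <= d.
Proof.
move=> d0.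
have : (fun n => c * (2^-1) ^+ n) @ \oo --> c * 0.
  by apply: cvgMr; apply: cvg_expr;
    rewrite ger0_norm ?invr_ge0// invf_lt1// ltr1n.
rewrite mulr0 => /cvgr0Pnorm_le /(_ d d0); apply: filterS => n.
exact: le_trans (ler_norm _).
Qed.

(** The outer factors cost only a constant, which disappears under n-th roots. *)
Lemma quasinilpotent_factor {R : realType} {H K : hilbertType R}
    {Q : bop H H} {P : bop K K} (A : bop K H) (B : bop H K) :
  (forall n x, (P ^+ n.+1) x = B ((Q ^+ n) (A x))) ->
  quasinilpotent Q -> quasinilpotent P.
Proof.
move=> PE /quasinilpotentP Q0; apply/quasinilpotentP => e e0.
have [a a0 Aa] := bop_bounded_pos A; have [b b0 Bb] := bop_bounded_pos B.
(* At half the target rate, the spare [2^-1 ^+ n] absorbs [b * a] and still leaves the factor [e]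
   demanded by the exponent [n.+1]. *)
have e20 : 0 < e / 2 by rewrite divr_gt0.
apply: near_inftyS; near=> n => x.
have Qn : forall x, `|(Q ^+ n) x| <= ((e / 2) ^+ n)%:C%C * `|x|.
  by near: n; exact: Q0.
have ben : b * a * 2^-1 ^+ n <= e by near: n; exact: near_le_geometric.
rewrite PE; apply: le_trans (Bb _) _.
have : b%:C%C * `|(Q ^+ n) (A x)| <=
    b%:C%C * ((e / 2) ^+ n)%:C%C * (a%:C%C * `|x|).
  rewrite -mulrA ler_wpM2l ?lecR//; apply: le_trans (Qn _) _.
  by rewrite ler_wpM2l// lecR exprn_ge0// (ltW e20).
move=> /le_trans; apply; rewrite mulrA -!rmorphM ler_wpM2r// lecR.
rewrite exprMn mulrAC [e ^+ n * _]mulrC mulrA exprS.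
by rewrite ler_wpM2r// exprn_ge0// (ltW e0).
Unshelve. all: by end_near. Qed.

(** * Generalized Drazin inverses: uniqueness and Cline's formula *)

Lemma bop_exp_bound {R : realType} {H : hilbertType R} (T : bop H H) :
  exists2 c : R, 0 < c & forall n x, `|(T ^+ n) x| <= (c ^+ n)%:C%C * `|x|.
Proof.
have [c c0 Tc] := bop_bounded_pos T.
(* [c] may be 0, while the bound is later inverted in the choice of a rate. *)
have d0 : 0 < c + 1 by rewrite ltr_wpDl.
exists (c + 1) => //; elim=> [|n IHn] x; first by rewrite !expr0 rmorph1 mul1r.
rewrite !exprS; apply: le_trans (Tc _) _.
rewrite rmorphM -mulrA; apply: ler_pM => //; rewrite ?lecR ?lerDl//.
Qed.

(** Powers of [A] and [B] grow at most geometrically, whereas those of [Q] decay faster than any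
    geometric sequence. *)
Lemma quasinilpotent_sandwich {R : realType} {H : hilbertType R}
    (Q A B E : bop H H) :
  quasinilpotent Q ->
  (forall n, E = A ^+ n.+1 * Q ^+ n.+1 * B ^+ n.+1) -> E = 0.
Proof.
move=> /quasinilpotentP Q0 EE.
have [a a0 Aa] := bop_exp_bound A; have [b b0 Bb] := bop_exp_bound B.
(* At this rate the three geometric bounds multiply to [2^-1 ^+ n]. *)
have e0 : 0 < (2 * a * b)^-1 by rewrite invr_gt0 !mulr_gt0.
have {}Q0 := Q0 _ e0.
apply: bopP => x /=; apply/eqP; rewrite -normr_eq0; apply/eqP.
have Nx (y : H) : `|y| = (complex.Re `|y|)%:C%C by rewrite RRe_real ?ger0_real.
rewrite Nx; congr (_%:C%C); apply/le_anti/andP; split; last first.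
  by rewrite -lecR -Nx normr_ge0.
apply/ler_addgt0Pr => d d0; rewrite add0r.
near \oo => n.
have n0 : (0 < n)%N by near: n; exact: nbhs_infty_gt.
have {}EE : E = A ^+ n * Q ^+ n * B ^+ n by rewrite -(prednK n0).
have Qn : forall x, `|(Q ^+ n) x| <= ((2 * a * b)^-1 ^+ n)%:C%C * `|x|.
  by near: n; exact: Q0.
have nd : complex.Re `|x| * 2^-1 ^+ n <= d.
  near: n; exact: near_le_geometric.
apply: le_trans nd; rewrite -lecR -Nx EE [X in X <= _]/(`|(A ^+ n) _|).
apply: le_trans (Aa _ _) _.
have := ler_wpM2l _ (Qn ((B ^+ n) x)).
move=> /(_ (a ^+ n)%:C%C); rewrite lecR exprn_ge0 ?(ltW a0)// => /(_ isT).
move=> /le_trans; apply.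
rewrite mulrA -rmorphM.
have -> : (complex.Re `|x| * 2^-1 ^+ n)%:C%C =
   (a ^+ n * (2 * a * b)^-1 ^+ n)%:C%C * ((b ^+ n)%:C%C * `|x|).
  have ab : 2^-1 = a * (2 * a * b)^-1 * b by field; rewrite !gt_eqF.
  by rewrite [in RHS]Nx -!rmorphM ab !exprMn mulrC mulrA.
by rewrite ler_wpM2l// lecR mulr_ge0 ?exprn_ge0 ?(ltW a0) ?(ltW e0).
Unshelve. all: by end_near. Qed.

Lemma idem_exprS {A : pzRingType} (e : A) n : e * e = e -> e ^+ n.+1 = e.
Proof. by move=> ee; elim: n => // n IHn; rewrite exprS IHn. Qed.

(* With p = T X and Q = T - T^2 X, the operator T Y (1 - p) equals Y^n Q^n, and
   (1 - p) T Y equals Q^n Y^n, for every n > 0; both vanish in the limit. *)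
Lemma gdrazin_absorb {R : realType} {H : hilbertType R} (T X Y : bop H H) :
  is_gdrazin T X -> is_gdrazin T Y ->
  T * Y = T * Y * (T * X) /\ T * Y = T * X * (T * Y).
Proof.
move=> [XTX TX Q0] [YTY TY _].
set Q := T - _ in Q0; pose p : bop H H := T * X.
have pT : GRing.comm p T by rewrite /GRing.comm /p -mulrA -TX.
have cT : GRing.comm T (1 - p).
  by apply: commrB; [exact: commr1|exact: commr_sym].
have QE : Q = T * (1 - p) by rewrite mulrBr mulr1 /Q expr2 mulrA.
have pp : (1 - p) * (1 - p) = 1 - p.
  by rewrite mulrBl mul1r mulrBr mulr1 /p -mulrA (mulrA X) XTX subrr subr0.
have Qn n : Q ^+ n.+1 = T ^+ n.+1 * (1 - p).
  by rewrite QE exprMn_comm// (idem_exprS _ _ pp).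
have qq : T * Y * (T * Y) = T * Y by rewrite -mulrA (mulrA Y) YTY.
have Tn n : T ^+ n.+1 * Y ^+ n.+1 = T * Y.
  by rewrite -exprMn_comm// idem_exprS.
have nT n : Y ^+ n.+1 * T ^+ n.+1 = T * Y.
  by rewrite -exprMn_comm -?TY// idem_exprS.
split; apply/eqP; rewrite -subr_eq0; apply/eqP.
  apply: (@quasinilpotent_sandwich _ _ Q Y 1) => // n.
  by rewrite expr1n mulr1 Qn [RHS]mulrA nT mulrBr mulr1.
apply: (@quasinilpotent_sandwich _ _ Q 1 Y) => // n.
rewrite expr1n mul1r Qn -(commrX n.+1 (commr_sym cT)).
by rewrite -[RHS]mulrA Tn mulrBl mul1r.
Qed.

(** Absorption in both orders gives [T X = T Y], whence X = X T X = X T Y = T X Y = T Y Y = Y. *)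
Lemma gdrazin_unique {R : realType} {H : hilbertType R} (T X Y : bop H H) :
  is_gdrazin T X -> is_gdrazin T Y -> X = Y.
Proof.
move=> gX gY; have [_ qpq] := gdrazin_absorb _ _ _ gX gY.
have [ppq _] := gdrazin_absorb _ _ _ gY gX.
have pq : T * X = T * Y by rewrite ppq -qpq.
have [XTX TX _] := gX; have [YTY TY _] := gY.
by rewrite -XTX -mulrA pq mulrA -TX pq TY.
Qed.

Lemma gdrazinE {R : realType} {H : hilbertType R} {T X : bop H H} :
  is_gdrazin T X -> T^D = X.
Proof.
move=> gX; apply: gdrazin_unique (gX).
by have := xgetPex 0 (ex_intro _ X gX : gdrazin_invertible T).
Qed.

(* Cline's formula; here (U V - (U V)^2 (U X^2 V))^(n+1) = U W Q^n V with
   W = 1 - V U X and Q = V U - (V U)^2 X, which yields quasinilpotence. *)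
Lemma gdrazin_cline {R : realType} {H K : hilbertType R}
    (U : bop H K) (V : bop K H) (X : bop H H) :
  is_gdrazin (V \oB U) X -> is_gdrazin (U \oB V) (U \oB X ^+ 2 \oB V).
Proof.
move=> [XTX TX Q0].
have Xx x : X (V (U (X x))) = X x.
  by exact: (congr1 (fun S : bop H H => S x) XTX).
have Tx x : V (U (X x)) = X (V (U x)).
  by exact: (congr1 (fun S : bop H H => S x) TX).
have XXx x : X (X (V (U x))) = X x by rewrite -Tx.
split.
- by apply: bopP => x /=; rewrite !Tx !XXx.
- by apply: bopP => x /=; rewrite !Tx.
pose W : bop H H := bid H - V \oB U \oB X.
apply: (quasinilpotent_factor
  (Q := V \oB U - (V \oB U) ^+ 2 * X) V (U \oB W)) => //.
set Q : bop H H := _ - _ * X; set P : bop K K := _ - _.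
have Wx y : W y = y - V (U (X y)) by [].
have PE y : P y = U (W (V y)).
  rewrite Wx linearB; congr (_ - _).
  by rewrite /= !Tx !XXx.
have QE y : Q y = V (U (W y)) by rewrite Wx !linearB /= !Tx.
elim=> [|n IHn] y; first by rewrite expr1 PE.
(* The extra factor is split off on the right, where [V (P y) = Q (V y)] carries it across [V]. *)
rewrite (exprSr P) (exprSr Q).
by rewrite [LHS]IHn PE -QE.
Qed.

(** * Orthogonal projections and operator blocks for the range and the adjoint's kernel *)

Lemma ortho_proj_incl {R : realType} {H : hilbertType R} {M : csubspace H}
    (m : M) : ortho_proj M (csub_incl M m) = m.
Proof.
apply: (@ortho_proj_uniq _ _ _ (csub_incl M m)) => n; first exact: ortho_projP.
by rewrite subrr linear0l.
Qed.

(** For [m = T z] and n in the kernel, adjointness moves T onto n, so m is orthogonal to n and 0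
    qualifies as its projection. *)
Lemma ortho_proj_ker_ran {R : realType} {H K : hilbertType R} {T : bop H K}
    (clT : closed (range T)) (m : csub_ran clT) :
  ortho_proj (csub_ker (adjoint T)) (csub_incl _ m) = 0.
Proof.
apply: (@ortho_proj_uniq _ _ _ (csub_incl _ m)) => n; first exact: ortho_projP.
rewrite (raddf0 (csub_incl _)) subr0.
case: m n => m /= /set_mem[z _ <-] [n /= /set_mem /= Tn].
by rewrite adjointP Tn linear0r.
Qed.

Lemma ortho_proj_ran_ker {R : realType} {H K : hilbertType R} {T : bop H K}
    (clT : closed (range T)) (n : csub_ker (adjoint T)) :
  ortho_proj (csub_ran clT) (csub_incl _ n) = 0.
Proof.
apply: (@ortho_proj_uniq _ _ _ (csub_incl _ n)) => m; first exact: ortho_projP.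
rewrite (raddf0 (csub_incl _)) subr0 innerC.
case: m n => m /= /set_mem[z _ <-] [n /= /set_mem /= Tn].
by rewrite adjointP Tn linear0r rmorph0.
Qed.

Lemma blockE {R : realType} {H : hilbertType R} {M N : csubspace H}
    (A : bop M M) (B : bop N M) (C : bop M N) (D : bop N N) (x : H) :
  block A B C D x =
    csub_incl M (A (ortho_proj M x) + B (ortho_proj N x)) +
    csub_incl N (C (ortho_proj M x) + D (ortho_proj N x)).
Proof. by []. Qed.

Theorem theorem13 (R : realType) (H : hilbertType R) (T : bop H H)
    (gdT : gdrazin_invertible T) (clT : closed (range T))
    (A1 : bop (csub_ran clT) (csub_ran clT))
    (A2 : bop (csub_ker (adjoint T)) (csub_ran clT))
    (TE : T = block A1 A2 0 0)
    (Tm : bop H H) (TmP : inner_inverse T Tm)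
    (Z1 : bop (csub_ran clT) (csub_ran clT))
    (Z2 : bop (csub_ker (adjoint T)) (csub_ran clT))
    (Z3 : bop (csub_ran clT) (csub_ker (adjoint T)))
    (Z4 : bop (csub_ker (adjoint T)) (csub_ker (adjoint T)))
    (TmE : Tm = block Z1 Z2 Z3 Z4) :
  [/\ A1 \oB Z1 + A2 \oB Z3 = bid (csub_ran clT),
      one_gd_inverse T Tm =
        block (Z1 \oB A1 \oB A1^D) (Z1 \oB A1^D \oB A2)
              (Z3 \oB A1 \oB A1^D) (Z3 \oB A1^D \oB A2),
      block (Z1 \oB A1 \oB A1^D) (Z1 \oB A1^D \oB A2)
            (Z3 \oB A1 \oB A1^D) (Z3 \oB A1^D \oB A2) =
        block (Z1 \oB A1 \oB A1^D) (Z1 \oB A1 \oB (A1^D) ^+ 2 \oB A2) 0 0 +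
        block 0 0 (Z3 \oB A1 \oB A1^D) (Z3 \oB A1^D \oB A2)
    & Z3 = 0 -> A1 \oB Z1 = Z1 \oB A1 -> one_gd_inverse T Tm = T^D].
Proof.
set M := csub_ran clT in A1 A2 TE Z1 Z2 Z3 Z4 TmE *.
set N := csub_ker (adjoint T) in A2 TE Z2 Z3 Z4 TmE *.
pose V := csub_incl M; pose U := A1 \oB ortho_proj M + A2 \oB ortho_proj N.
have Vinj (x y : M) : V x = V y -> x = y by exact: val_inj.
have PV (m : M) : ortho_proj M (V m) = m by exact: ortho_proj_incl.
have QV (m : M) : ortho_proj N (V m) = 0 by exact: ortho_proj_ker_ran.
have Ux x : U x = A1 (ortho_proj M x) + A2 (ortho_proj N x) by [].
have TVU : T = V \oB U.
  by rewrite TE; apply: bopP => x; rewrite /= !addr0.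
have UVA : U \oB V = A1.
  by apply: bopP => x; rewrite [LHS]Ux PV QV linear0 addr0.
have [X gX] := gdT.
(* [A1^D] would be the default 0 if [A1] had no generalized Drazin inverse; Cline's formula supplies
   one from [X]. *)
have gY : is_gdrazin A1 A1^D.
  rewrite -UVA; rewrite TVU in gX.
  by have gUV := gdrazin_cline _ _ _ gX; rewrite (gdrazinE gUV).
set Y := A1^D in gY *.
(* Cline's formula in the opposite direction, from [U V] back to [V U]. *)
have TD : T^D = V \oB Y ^+ 2 \oB U.
  by apply: gdrazinE; rewrite TVU; apply: gdrazin_cline; rewrite UVA.
have [YAY AY _] := gY.
have AYx x : A1 (Y x) = Y (A1 x).
  by exact: (congr1 (fun S : bop M M => S x) AY).
have YAYx x : Y (A1 (Y x)) = Y x.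
  by exact: (congr1 (fun S : bop M M => S x) YAY).
have TmV x : Tm (V x) = V (Z1 x) + csub_incl N (Z3 x).
  by rewrite TmE blockE PV QV !linear0 !addr0.
have UTm x : U (Tm (V x)) = x.
  (* A point of the range is [T z = V (U z)], and [V] is injective. *)
  have [z zx] : exists z, U z = x.
    case: (x) => v vM; have [z _ zv] := set_mem vM.
    by exists z; apply: Vinj; rewrite -[LHS]/((V \oB U) z) -TVU.
  rewrite -zx; apply: Vinj.
  have := congr1 (fun S : bop H H => S z) TmP.
  by rewrite /= TVU.
have UV m : U (V m) = A1 m by rewrite -UVA.
have UW n : U (csub_incl N n) = A2 n.
  by rewrite Ux ortho_proj_ran_ker ortho_proj_incl linear0 add0r.
have GDE x : one_gd_inverse T Tm x = Tm (V (Y (U x))).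
  (* The inner [U V] is [A1], and [A1 Y Y = Y A1 Y = Y]. *)
  rewrite /one_gd_inverse TD {1}TVU -[LHS]/(Tm (V (U (V (Y (Y (U x))))))).
  by rewrite UV AYx YAYx.
split.
- apply: bopP => x; rewrite -[RHS](UTm x) TmV.
  have -> y z : U (y + z) = U y + U z by exact: linearD.
  by rewrite UV UW.
- apply: bopP => x; rewrite GDE TmV blockE Ux.
  by rewrite /= !linearD /= !AYx.
(* Only the upper right entries differ in form. *)
- have -> : Z1 \oB A1 \oB Y ^+ 2 \oB A2 = Z1 \oB Y \oB A2.
    apply: bopP => y; rewrite -[LHS]/(Z1 (A1 (Y (Y (A2 y))))).
    by rewrite AYx YAYx.
  by apply: bopP => x; rewrite /= !addr0 !add0r.
- move=> Z30 AZ.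
  (* With [Z3 = 0], the identity [U Tm V = 1] becomes [A1 Z1 = 1]; commutation makes [Z1] a left
     inverse too. *)
  have Z1A x : Z1 (A1 x) = x.
    rewrite -[LHS]/((Z1 \oB A1) x) -AZ -[RHS](UTm x) TmV Z30.
    by rewrite linear0 addr0 UV.
  apply: bopP => x; rewrite GDE TmV Z30 linear0 addr0 TD.
  (* Expanding [Y] as [A1 Y Y] lets [Z1] cancel [A1]. *)
  by rewrite -[RHS]/(V (Y (Y (U x)))) -[in LHS]YAYx -AYx Z1A.
Qed.
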